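(* Consider the setting of the context (no state constraints, $\mathcal{X}=\mathbb{R}^{N_x}$; no shared input constraints, $\mathcal{U}_{\mathcal{G}}=\prod_{p\in\mathcal{P}}\mathbb{R}^{N_u^p}$), with $\mathcal{U}^p=\{u\in\mathbb{R}^{N_u^p}:G_u^pu\preceq\mathbf{1}\}$ where $G_u^p$ has full row rank, for each $p\in\mathcal{P}$. Then the joint best-response map $\widehat{BR}_\Phi$ is $L_{\widehat{BR}_\Phi}$-Lipschitz (with respect to the $\ell_2$, i.e. Frobenius, norm) with $$L_{\widehat{BR}_\Phi}^2=\sum_{p\in\mathcal{P}}\big(L_{\widehat{BR}_\Phi}^p\big)^2,\qquad L_{\widehat{BR}_\Phi}^p=\frac{\sigma_{\max}(H^{p,-p})}{\sigma_{\min}(H^{pp})}.$$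
   Context: **Data.** Players $\mathcal{P}=\{1,\dots,N_P\}$, horizon $N>1$, matrices $A\in\mathbb{R}^{N_x\times N_x}$, $B^p\in\mathbb{R}^{N_x\times N_u^p}$, $C^p\in\mathbb{R}^{N_z\times N_x}$, $D^{p\tilde p}\in\mathbb{R}^{N_z\times N_u^{\tilde p}}$ ($p,\tilde p\in\mathcal{P}$). Standing assumptions: $(A,B^p)$ stabilisable, $(C^p,A)$ detectable, $D^{pp}$ of full column rank, $(D^{p\tilde p})^{\mathsf T}C^p=0$ for all $p,\tilde p$. **Strategies.** A strategy of player $p$ is a finite-impulse-response kernel $\Phi_u^p=(\Phi_{u,n}^p)_{n=1}^{N-1}$, $\Phi_{u,n}^p\in\mathbb{R}^{N_u^p\times N_x}$, viewed as a stacked matrix in $\mathbb{R}^{(N-1)N_u^p\times N_x}$. $\Phi_u^{-p}=(\Phi_u^{\tilde p})_{\tilde p\ne p}$ is the stack over the other players, and $\Phi_u=(\Phi_u^p)_{p\in\mathcal{P}}$. The associated state response $\Phi_x=(\Phi_{x,n})_{n=1}^N$ is $\Phi_{x,1}=I_{N_x}$, $\Phi_{x,n+1}=A\Phi_{x,n}+\sum_pB^p\Phi_{u,n}^p$, i.e. $\Phi_x=F^0+\sum_pF^p\Phi_u^p$ with $(F^0)_n=A^{n-1}$ and $(F^p\Phi)_n=\sum_{m=1}^{n-1}A^{n-1-m}B^p\Phi_m$. **Operators.** $C^p$ and $D^{p\tilde p}$ also denote the operators acting entrywise in $n$ on kernels ($D^{p\tilde p}\Phi$ is padded by $0$ at $n=N$),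 and $D^{p0}=0$. For $p\in\mathcal{P}$ and $\tilde p\in\mathcal{P}\cup\{0\}$, $$H^{p\tilde p}=(C^pF^p+D^{pp})^{\mathsf T}(C^pF^{\tilde p}+D^{p\tilde p}),$$ identified with its matrix representation acting on stacked kernels, and $H^{p,-p}=[H^{p\tilde p}]_{\tilde p\in\mathcal{P}\setminus\{p\}}$ is the block row, so that $H^{p,-p}\Phi_u^{-p}=\sum_{\tilde p\ne p}H^{p\tilde p}\Phi_u^{\tilde p}$. $\sigma_{\max},\sigma_{\min}$ denote largest and smallest singular values. **Best response.** The noise set is $\mathcal{W}=\{w\in\mathbb{R}^{N_x}:\|w\|_\infty\le1\}$, there are no structural (sparsity) constraints on the kernels, and the terminal constraint $\|\Phi_{x,N}\|_F^2\le\gamma$ is assumed to be strictly satisfied (inactive), hence is omitted. Robust satisfaction of $\mathcal{U}^p$ then reads $\big\|\big([G_u^p]_j[\Phi_{u,1}^p\ \cdots\ \Phi_{u,N-1}^p]\big)^{\mathsf T}\big\|_1\le1$ for every row $[G_u^p]_j$ of $G_u^p$. The best response of player $p$ is $$\widehat{BR}_\Phi^p(\Phi_u^{-p})=\arg\min_{\Phi_u^p}\ \mathrm{Tr}\Big[(\Phi_u^p)^{\mathsf T}H^{pp}\Phi_u^p+2\big(H^{p,-p}\Phi_u^{-p}+H^{p0}\big)^{\mathsf T}\Phi_u^p\Big]$$ over all $\Phi_u^p$ satisfying these row-wise $\ell_1$ constraints, and $\widehat{BR}_\Phi(\Phi_u)=\widehat{BR}_\Phi^1(\Phi_u^{-1})\times\cdots\times\widehat{BR}_\Phi^{N_P}(\Phi_u^{-N_P})$.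 A set-valued map $F$ is $L$-Lipschitz if $\|a-b\|\le L\|x-y\|$ for all $x,y$ in its domain, $a\in F(x)$, $b\in F(y)$. *)

(* Defs.v *)
From HB Require Import structures.
From mathcomp Require Import all_boot all_order all_algebra.
From mathcomp Require Import complex.
From mathcomp Require Import mathcomp_extra boolp classical_sets reals.

Set Implicit Arguments.
Unset Strict Implicit.
Unset Printing Implicit Defensive.

Import Order.TTheory GRing.Theory Num.Theory.
Local Open Scope classical_set_scope.
Local Open Scope ring_scope.

Section MatrixNotions.
Variable R : realType.

Definition frob m n (M : 'M[R]_(m, n)) : R :=
  Num.sqrt (\sum_i \sum_j M i j ^+ 2).

Definition l1norm n (v : 'cV[R]_n) : R := \sum_i `|v i 0|.

(* An m x n matrix has min(m, n) singular values, hence the choice of the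
   smaller Gram matrix. *)
Definition singular_values m n (M : 'M[R]_(m, n)) : set R :=
  [set s | 0 <= s /\
    if (n <= m)%N then eigenvalue (M^T *m M) (s ^+ 2)
    else eigenvalue (M *m M^T) (s ^+ 2)].

(* The set of singular values is finite, so sup and inf are its maximum and
   minimum; both are 0 for a matrix with no rows or no columns. *)
Definition sigma_max m n (M : 'M[R]_(m, n)) : R := sup (singular_values M).
Definition sigma_min m n (M : 'M[R]_(m, n)) : R := inf (singular_values M).

(* Discrete-time stability: all complex eigenvalues in the open unit disc. *)
Definition schur_stable n (M : 'M[R]_n) : Prop :=
  forall z : R[i], eigenvalue (map_mx (real_complex R) M) z -> `|z| < 1.

Definition stabilisable n m (A : 'M[R]_n) (B : 'M[R]_(n, m)) : Prop :=
  exists K : 'M[R]_(m, n), schur_stable (A + B *m K).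

Definition detectable m n (C : 'M[R]_(m, n)) (A : 'M[R]_n) : Prop :=
  exists L : 'M[R]_(n, m), schur_stable (A + L *m C).

Definition argmin (T : Type) (S : set T) (f : T -> R) : set T :=
  [set x | S x /\ forall y, S y -> f x <= f y].

(* Set-valued map F, Lipschitz with constant L for the Frobenius norm. *)
Definition set_lipschitz m n k l (L : R)
    (F : 'M[R]_(m, n) -> set 'M[R]_(k, l)) : Prop :=
  forall x y a b, F x a -> F y b -> frob (a - b) <= L * frob (x - y).

End MatrixNotions.

(* Block indices are 0-based: n : 'I_N stands for time n + 1, so kernels
   (times 1, ..., N - 1) have blocks indexed by 'I_N.-1. *)
Section Game.
Variables (R : realType) (NP N Nx Nz : nat) (Nu : 'I_NP -> nat).
Variables (A : 'M[R]_Nx) (B : forall p, 'M[R]_(Nx, Nu p)).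
Variables (C : 'I_NP -> 'M[R]_(Nz, Nx)).
Variables (D : forall p q : 'I_NP, 'M[R]_(Nz, Nu q)).
Variables (Ng : 'I_NP -> nat) (G : forall p, 'M[R]_(Ng p, Nu p)).

Definition F0 : 'M[R]_(\sum_(n < N) Nx, Nx) := \mxcol_(n < N) (A ^+ n).

(* At times n + 1 and m + 1 the exponent (n + 1) - 1 - (m + 1) is n - m - 1. *)
Definition Fop (p : 'I_NP) :
    'M[R]_(\sum_(n < N) Nx, \sum_(m < N.-1) Nu p) :=
  \mxblock_(n < N, m < N.-1)
    (if (m < n)%N then A ^+ (n - m - 1) *m B p else 0).

Definition Cop (p : 'I_NP) : 'M[R]_(\sum_(n < N) Nz, \sum_(n < N) Nx) :=
  \mxblock_(n < N, m < N) (if n == m then C p else 0).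

(* The last block row (time N) is zero. *)
Definition Dop (p q : 'I_NP) :
    'M[R]_(\sum_(n < N) Nz, \sum_(m < N.-1) Nu q) :=
  \mxblock_(n < N, m < N.-1) (if n == m :> nat then D p q else 0).

Definition H (p q : 'I_NP) :
    'M[R]_(\sum_(n < N.-1) Nu p, \sum_(m < N.-1) Nu q) :=
  (Cop p *m Fop p + Dop p p)^T *m (Cop p *m Fop q + Dop p q).

(* H^{p0}, with D^{p0} = 0. *)
Definition H0 (p : 'I_NP) : 'M[R]_(\sum_(n < N.-1) Nu p, Nx) :=
  (Cop p *m Fop p + Dop p p)^T *m (Cop p *m F0).

(* H^{p,-p}: [lift p] enumerates the players other than p in order. *)
Definition Hothers (p : 'I_NP) :
    'M[R]_(\sum_(n < N.-1) Nu p,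
           \sum_(j < NP.-1) \sum_(m < N.-1) Nu (lift p j)) :=
  \mxrow_(j < NP.-1) H p (lift p j).

Definition player (Phi : 'M[R]_(\sum_p \sum_(n < N.-1) Nu p, Nx))
    (p : 'I_NP) : 'M[R]_(\sum_(n < N.-1) Nu p, Nx) :=
  submxcol Phi p.

Definition others (Phi : 'M[R]_(\sum_p \sum_(n < N.-1) Nu p, Nx))
    (p : 'I_NP) :
    'M[R]_(\sum_(j < NP.-1) \sum_(m < N.-1) Nu (lift p j), Nx) :=
  \mxcol_(j < NP.-1) player Phi (lift p j).

Definition side_by_side (p : 'I_NP)
    (Phi : 'M[R]_(\sum_(n < N.-1) Nu p, Nx)) :
    'M[R]_(Nu p, \sum_(n < N.-1) Nx) :=
  \mxrow_(n < N.-1) submxcol Phi n.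

(* Kernels whose inputs satisfy G^p u <= 1 for every disturbance sequence with
   values in the unit ball of the sup norm: the dual norm is the l1 norm. *)
Definition feasible (p : 'I_NP) :
    set 'M[R]_(\sum_(n < N.-1) Nu p, Nx) :=
  [set Phi | forall j, l1norm (row j (G p) *m side_by_side Phi)^T <= 1].

Definition cost (p : 'I_NP)
    (Phi_others :
      'M[R]_(\sum_(j < NP.-1) \sum_(m < N.-1) Nu (lift p j), Nx))
    (Phi : 'M[R]_(\sum_(n < N.-1) Nu p, Nx)) : R :=
  \tr (Phi^T *m H p p *m Phi
       + 2 *: ((Hothers p *m Phi_others + H0 p)^T *m Phi)).

Definition best_response (p : 'I_NP)
    (Phi_others :
      'M[R]_(\sum_(j < NP.-1) \sum_(m < N.-1) Nu (lift p j), Nx)) :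
    set 'M[R]_(\sum_(n < N.-1) Nu p, Nx) :=
  argmin (@feasible p) (cost Phi_others).

Definition joint_best_response
    (Phi : 'M[R]_(\sum_p \sum_(n < N.-1) Nu p, Nx)) :
    set 'M[R]_(\sum_p \sum_(n < N.-1) Nu p, Nx) :=
  [set Psi | forall p, best_response (others Phi p) (player Psi p)].

Definition lip_player (p : 'I_NP) : R :=
  sigma_max (Hothers p) / sigma_min (H p p).

End Game.

(* Main.v *)
(* Comparing the optimality of two best responses X and Y of player p, to Phi
   and Psi, along the segment joining them (the feasible set is convex) gives
     <X - Y, H^{pp} (X - Y)> <= <H^{p,-p} (Psi - Phi), X - Y>.
   The left side is at least sigma_min(H^{pp}) ||X - Y||^2, the right side at
   most sigma_max(H^{p,-p}) ||Psi - Phi|| ||X - Y||. The singular values enter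
   through Rayleigh quotients, and sigma_min(H^{pp}) > 0 because
   H^{pp} = M^T M with M = C^p F^p + D^{pp}, where D^{pp} has full column rank
   and (D^{pp})^T C^p = 0. Squaring and summing over p gives the claim. *)
Require Import Defs.
From mathcomp Require Import all_boot all_order all_algebra.
From mathcomp Require Import complex ring lra.
From mathcomp Require Import classical_sets reals.
Import Order.TTheory GRing.Theory Num.Theory.
Local Open Scope ring_scope.
Local Open Scope sesquilinear_scope.

Set Implicit Arguments.
Unset Strict Implicit.
Unset Printing Implicit Defensive.

(** * The Frobenius inner product and its norm *)

Section InnerProduct.
Variable R : realType.

Definition mxdot m n (X Y : 'M[R]_(m, n)) : R := \tr (X^T *m Y).

Lemma mxdotE m n (X Y : 'M[R]_(m, n)) :
  mxdot X Y = \sum_i \sum_j X i j * Y i j.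
Proof.
rewrite exchange_big; apply: eq_bigr => j _; rewrite !mxE.
by apply: eq_bigr => i _; rewrite !mxE.
Qed.

Lemma mxdotC m n (X Y : 'M[R]_(m, n)) : mxdot X Y = mxdot Y X.
Proof. by rewrite /mxdot -mxtrace_tr trmx_mul trmxK. Qed.

Lemma mxdotDl m n (X Y Z : 'M[R]_(m, n)) :
  mxdot (X + Y) Z = mxdot X Z + mxdot Y Z.
Proof. by rewrite /mxdot linearD mulmxDl linearD. Qed.

Lemma mxdotDr m n (X Y Z : 'M[R]_(m, n)) :
  mxdot X (Y + Z) = mxdot X Y + mxdot X Z.
Proof. by rewrite /mxdot mulmxDr linearD. Qed.

Lemma mxdotZl m n a (X Y : 'M[R]_(m, n)) : mxdot (a *: X) Y = a * mxdot X Y.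
Proof. by rewrite /mxdot linearZ -scalemxAl linearZ. Qed.

Lemma mxdotZr m n a (X Y : 'M[R]_(m, n)) : mxdot X (a *: Y) = a * mxdot X Y.
Proof. by rewrite /mxdot -scalemxAr linearZ. Qed.

Lemma mxdot_mulmxl m n k (M : 'M[R]_(m, n)) (X : 'M[R]_(n, k)) Y :
  mxdot (M *m X) Y = mxdot X (M^T *m Y).
Proof. by rewrite /mxdot trmx_mul mulmxA. Qed.

Lemma frob_sqr m n (X : 'M[R]_(m, n)) : frob X ^+ 2 = mxdot X X.
Proof.
rewrite sqr_sqrtr ?mxdotE //.
by apply: sumr_ge0 => i _; apply: sumr_ge0 => j _; rewrite sqr_ge0.
Qed.

Lemma frob_ge0 m n (X : 'M[R]_(m, n)) : 0 <= frob X.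
Proof. exact: sqrtr_ge0. Qed.

Lemma mxdot_ge0 m n (X : 'M[R]_(m, n)) : 0 <= mxdot X X.
Proof. by rewrite -frob_sqr sqr_ge0. Qed.

Lemma frob_eq0 m n (X : 'M[R]_(m, n)) : (frob X == 0) = (X == 0).
Proof.
rewrite -sqrf_eq0 frob_sqr mxdotE; apply/eqP/eqP => [X0|->]; last first.
  by rewrite big1 // => i _; rewrite big1 // => j _; rewrite mxE mul0r.
apply/matrixP => i j; rewrite mxE; apply/eqP; rewrite -sqrf_eq0; apply/eqP.
have sq_ge0 i' j' : 0 <= X i' j' * X i' j' by rewrite -expr2 sqr_ge0.
have := psumr_eq0P (fun i' _ => sumr_ge0 _ (fun j' _ => sq_ge0 i' j')) X0.
by move=> /(_ i isT) /(psumr_eq0P (fun j' _ => sq_ge0 i j')) /(_ j isT).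
Qed.

Lemma frobN m n (X : 'M[R]_(m, n)) : frob (- X) = frob X.
Proof. by congr Num.sqrt; do 2!apply: eq_bigr => ? _; rewrite mxE sqrrN. Qed.

Lemma matrix_neq0_rows m n (X : 'M[R]_(m, n)) : X != 0 -> (0 < m)%N.
Proof. by case: m X => // X; rewrite flatmx0 eqxx. Qed.

(** Cauchy-Schwarz: the squared norm of [frob Y *: X - frob X *: Y] is nonnegative and has the
    factor [frob X * frob Y], which is divided out once the zero cases are set aside. *)
Lemma mxdot_le_frob m n (X Y : 'M[R]_(m, n)) : mxdot X Y <= frob X * frob Y.
Proof.
have [Y0|Y_neq0] := eqVneq (frob Y) 0.
  have /eqP -> : Y == 0 by rewrite -frob_eq0 Y0.
  by rewrite -(scale0r 0) mxdotZr mul0r mulr_ge0 ?frob_ge0.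
have [X0|X_neq0] := eqVneq (frob X) 0.
  have /eqP -> : X == 0 by rewrite -frob_eq0 X0.
  by rewrite -(scale0r 0) mxdotZl mul0r mulr_ge0 ?frob_ge0.
have := mxdot_ge0 (frob Y *: X - frob X *: Y).
rewrite -scaleNr !(mxdotDl, mxdotDr, mxdotZl, mxdotZr) (mxdotC Y X) -!frob_sqr.
have X_gt0 : 0 < frob X by rewrite lt_def X_neq0 frob_ge0.
have Y_gt0 : 0 < frob Y by rewrite lt_def Y_neq0 frob_ge0.
move=> h; rewrite -subr_ge0 -(pmulr_rge0 _ (mulr_gt0 X_gt0 Y_gt0)).
nra.
Qed.

(** * Spectral decomposition and Rayleigh quotients of real symmetric matrices *)

Local Notation toC := (real_complex R).

(* The [w i] are the squared norms of the components of [X] along an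
   orthonormal eigenbasis of [S]. *)
Lemma symmetric_spectral n (S : 'M[R]_n) : S^T = S ->
  exists2 l : 'I_n -> R, (forall i, eigenvalue S (l i)) &
    forall k (X : 'M[R]_(n, k)), exists2 w : 'I_n -> R, (forall i, 0 <= w i) &
      mxdot X (S *m X) = \sum_i l i * w i /\ mxdot X X = \sum_i w i.
Proof.
move=> S_sym.
pose Sc := map_mx toC S.
have Sc_herm : Sc \is hermsymmx.
  apply/is_hermitianmxP; rewrite expr0 scale1r; apply/matrixP => i j.
  by rewrite !mxE -{1}S_sym mxE; apply/esym/conjc_real.
set P := spectralmx Sc; set d := spectral_diag Sc.
have P_unit : P \is unitarymx by exact: spectral_unitarymx.
have ScE : Sc = P^t* *m diag_mx d *m P.
  by rewrite -invmx_unitary //; apply/orthomx_spectralP/hermitian_normalmx.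
have PtP : P^t* *m P = 1%:M.
  by rewrite -invmx_unitary // mulVmx // unitarymx_unit.
(* The spectral theorem is applied over the complex numbers; a Hermitian matrix has real
   eigenvalues, so they descend to eigenvalues of [S]. *)
have dE i : d 0 i = toC (complex.Re (d 0 i)).
  apply/esym/RRe_real.
  by have /mxOverP := hermitian_spectral_diag_real Sc_herm; apply.
exists (fun i => complex.Re (d 0 i)) => [i|k X].
  have -> : eigenvalue S (complex.Re (d 0 i)) = eigenvalue Sc (d 0 i).
    by rewrite [in RHS]dE eigenvalue_map.
  (* Eigenvectors are row vectors here: the rows of the unitary [P] qualify, and none is zero
     because each has unit norm. *)
  apply/eigenvalueP; exists (row i P).
    rewrite ScE -row_mul !mulmxA (unitarymxP P_unit) mul1mx.
    by apply/rowP => j; rewrite !mxE (bigD1 i) //= big1 ?addr0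
        => [|l /negPf l_i]; rewrite !mxE ?eqxx ?mulr1n // eq_sym l_i mul0r.
  apply/eqP => P_i0; have /matrixP/(_ i i) := unitarymxP P_unit.
  rewrite [_ i i]mxE [RHS]mxE eqxx big1 => [/eqP|j _].
    by rewrite eq_sym oner_eq0.
  by have /rowP/(_ j) := P_i0; rewrite !mxE => ->; rewrite mul0r.
pose Xc := map_mx toC X; pose Y := P *m Xc.
have XcE : Xc^T = Xc^t*.
  by apply/matrixP => i j; rewrite !mxE; apply/esym/conjc_real.
pose w i := \sum_j (complex.Re (Y i j) ^+ 2 + complex.Im (Y i j) ^+ 2).
(* Taken for arbitrary [D]: [D = d] yields the quadratic form of [S], and [D = 1] the squared norm
   of [X]. *)
have YtDY D : \tr (Y^t* *m diag_mx D *m Y) = \sum_i D 0 i * toC (w i).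
  rewrite /mxtrace; under eq_bigr => j _ do rewrite -mulmxA mxE.
  rewrite exchange_big; apply: eq_bigr => i _; rewrite rmorph_sum mulr_sumr.
  apply: eq_bigr => j _; rewrite mul_diag_mx !mxE mulrCA; congr (_ * _).
by rewrite [RHS]add_Re2_Im2 normCK mulrC.
have YtY : \tr (Y^t* *m Y) = \sum_i toC (w i).
  have -> : Y^t* *m Y = Y^t* *m diag_mx (const_mx 1) *m Y.
    by rewrite diag_const_mx mulmx1.
  rewrite YtDY.
  by apply: eq_bigr => i _; rewrite mxE mul1r.
exists w => [i|].
  by apply: sumr_ge0 => j _; rewrite addr_ge0 ?sqr_ge0.
have toC_mxdot Z : toC (mxdot X Z) = \tr (Xc^t* *m map_mx toC Z).
  by rewrite -XcE map_trmx -map_mxM trace_map_mx.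
split; apply: (@complexI R).
- rewrite toC_mxdot map_mxM -/Sc -/Xc ScE.
  rewrite rmorph_sum /=; under eq_bigr do rewrite rmorphM /= -dE.
  by rewrite -YtDY /Y trmx_mul map_mxM !mulmxA.
- rewrite toC_mxdot -/Xc rmorph_sum -YtY /Y trmx_mul map_mxM.
  by rewrite mulmxA -[Xc ^t* *m _ *m _]mulmxA PtP mulmx1.
Qed.

Lemma eigenvalue_rayleigh n (S : 'M[R]_n) a : S^T = S -> eigenvalue S a ->
  exists2 v : 'cV[R]_n, mxdot v (S *m v) = a * mxdot v v & 0 < mxdot v v.
Proof.
move=> S_sym /eigenvalueP[v Sv v_neq0]; exists v^T.
  by rewrite -{1}S_sym -trmx_mul Sv linearZ mxdotZr.
by rewrite lt_def mxdot_ge0 andbT -frob_sqr sqrf_eq0 frob_eq0 trmx_eq0.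
Qed.

Lemma rayleigh_le n k (S : 'M[R]_n) (X : 'M[R]_(n, k)) b : S^T = S ->
  (forall a, eigenvalue S a -> a <= b) -> mxdot X (S *m X) <= b * mxdot X X.
Proof.
move=> /symmetric_spectral[l eig_l spec] le_b.
have [w w_ge0 [-> ->]] := spec _ X.
by rewrite mulr_sumr ler_sum // => i _; rewrite ler_wpM2r ?le_b.
Qed.

Lemma rayleigh_ge n k (S : 'M[R]_n) (X : 'M[R]_(n, k)) b : S^T = S ->
  (forall a, eigenvalue S a -> b <= a) -> b * mxdot X X <= mxdot X (S *m X).
Proof.
move=> /symmetric_spectral[l eig_l spec] ge_b.
have [w w_ge0 [-> ->]] := spec _ X.
by rewrite mulr_sumr ler_sum // => i _; rewrite ler_wpM2r ?ge_b.
Qed.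

(** Each eigenvalue is a Rayleigh quotient, hence a weighted mean of the [l i]; the sum of their
    absolute values bounds it and makes sense for [n = 0] too. *)
Lemma symmetric_eigenvalue_ub n (S : 'M[R]_n) : S^T = S ->
  exists b, forall a, eigenvalue S a -> a <= b.
Proof.
move=> S_sym; have [l eig_l spec] := symmetric_spectral S_sym.
exists (\sum_i `|l i|) => a /(eigenvalue_rayleigh S_sym)[v Sv v_gt0].
have [w w_ge0 [E1 E2]] := spec _ v.
rewrite -(ler_pM2r v_gt0) -Sv E1 E2 mulr_suml ler_sum // => i _.
rewrite (le_trans (ler_wpM2r (w_ge0 i) (ler_norm _))) // ler_wpM2l //.
by rewrite (bigD1 i) //= lerDl sumr_ge0.
Qed.

Lemma symmetric_eigenvalue_min n (S : 'M[R]_n) : (0 < n)%N -> S^T = S ->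
  exists2 a, eigenvalue S a & forall b, eigenvalue S b -> a <= b.
Proof.
move=> n_gt0 S_sym; have [l eig_l spec] := symmetric_spectral S_sym.
have [i0 _ l_min] :=
  @Order.TotalTheory.arg_minP _ _ _ (Ordinal n_gt0) predT l isT.
exists (l i0) => // b /(eigenvalue_rayleigh S_sym)[v Sv v_gt0].
have [w w_ge0 [E1 E2]] := spec _ v.
rewrite -(ler_pM2r v_gt0) -Sv E1 E2 mulr_sumr ler_sum // => i _.
by rewrite ler_wpM2r // l_min.
Qed.

(** * Gram matrices and bounds by extreme singular values *)

Lemma gram_sym m n (M : 'M[R]_(m, n)) : (M^T *m M)^T = M^T *m M.
Proof. by rewrite trmx_mul trmxK. Qed.

Lemma mxdot_gram m n k (M : 'M[R]_(m, n)) (X : 'M[R]_(n, k)) :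
  mxdot X (M^T *m M *m X) = frob (M *m X) ^+ 2.
Proof. by rewrite -mulmxA -mxdot_mulmxl frob_sqr. Qed.

Lemma eigenvalue_gram_ge0 m n (M : 'M[R]_(m, n)) a :
  eigenvalue (M^T *m M) a -> 0 <= a.
Proof.
move=> /(eigenvalue_rayleigh (gram_sym M))[v Mv v_gt0].
by rewrite -(pmulr_lge0 a v_gt0) -Mv mxdot_gram sqr_ge0.
Qed.

(** By adjunction and Cauchy-Schwarz, the square of [frob (M *m X)] is at most
    [frob X * (L * frob (M *m X))]; one factor cancels. *)
Lemma frob_mulmx_tr m n (M : 'M[R]_(m, n)) L : 0 <= L ->
  (forall k (Y : 'M[R]_(m, k)), frob (M^T *m Y) <= L * frob Y) ->
  forall k (X : 'M[R]_(n, k)), frob (M *m X) <= L * frob X.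
Proof.
move=> L_ge0 MtL k X; have [->|MX_neq0] := eqVneq (frob (M *m X)) 0.
  by rewrite mulr_ge0 ?frob_ge0.
have MX_gt0 : 0 < frob (M *m X) by rewrite lt_def MX_neq0 frob_ge0.
rewrite -(ler_pM2r MX_gt0) -expr2 frob_sqr mxdot_mulmxl.
rewrite (le_trans (mxdot_le_frob _ _)) // mulrAC mulrC.
by rewrite ler_wpM2r ?frob_ge0 ?MtL.
Qed.

Lemma frob_le_of_gram m n (M : 'M[R]_(m, n)) s : 0 <= s ->
  (forall a, eigenvalue (M^T *m M) a -> Num.sqrt a <= s) ->
  forall k (X : 'M[R]_(n, k)), frob (M *m X) <= s * frob X.
Proof.
move=> s_ge0 le_s k X.
rewrite -(@ler_pXn2r _ 2) ?nnegrE ?mulr_ge0 ?frob_ge0 //.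
rewrite exprMn -mxdot_gram frob_sqr; apply: rayleigh_le (gram_sym M) _.
move=> a eig_a; rewrite -(sqr_sqrtr (eigenvalue_gram_ge0 eig_a)).
by rewrite ler_pXn2r ?nnegrE ?sqrtr_ge0 ?le_s.
Qed.

Lemma singular_values_has_ubound m n (M : 'M[R]_(m, n)) :
  has_ubound (singular_values M).
Proof.
have [b1 ub1] := symmetric_eigenvalue_ub (gram_sym M).
have := gram_sym M^T; rewrite trmxK => /symmetric_eigenvalue_ub[b2 ub2].
(* The eigenvalue bounds control [s ^+ 2]; adding 1 avoids a square root, since
   [s <= s ^+ 2 + 1]. *)
exists (Num.max b1 b2 + 1) => s [s_ge0 s_eig].
have : s ^+ 2 <= Num.max b1 b2.
  by rewrite le_max; case: ifP s_eig => _ => [/ub1->|/ub2->]; rewrite ?orbT.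
by move: (Num.max b1 b2) => b; nra.
Qed.

Lemma sigma_max_ge0 m n (M : 'M[R]_(m, n)) : 0 <= sigma_max M.
Proof.
have [M0|/set0P[s Ms]] := eqVneq (singular_values M) set0.
  by rewrite /sigma_max M0 sup0.
by apply: le_trans (ub_le_sup (singular_values_has_ubound M) Ms); case: Ms.
Qed.

(** For [n <= m] the singular values come from [M^T *m M], and the Rayleigh bound applies directly.
    For wide [M] they come from [M *m M^T], so the bound is first obtained for [M^T] and then
    transposed. *)
Lemma frob_mulmx_le m n k (M : 'M[R]_(m, n)) (X : 'M[R]_(n, k)) :
  frob (M *m X) <= sigma_max M * frob X.
Proof.
have le_sigma s : singular_values M s -> s <= sigma_max M.
  by move=> Ms; apply: ub_le_sup (singular_values_has_ubound M) _ Ms.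
have [n_le_m|m_lt_n] := leqP n m.
  apply: frob_le_of_gram (sigma_max_ge0 M) _ _ _ => a eig_a.
  apply: le_sigma; split; first exact: sqrtr_ge0.
  by rewrite n_le_m sqr_sqrtr ?(eigenvalue_gram_ge0 eig_a).
apply: frob_mulmx_tr (sigma_max_ge0 M) _ _ _ => k' Y.
apply: frob_le_of_gram (sigma_max_ge0 M) _ _ _ => a eig_a.
apply: le_sigma; split; first exact: sqrtr_ge0.
rewrite leqNgt m_lt_n /= sqr_sqrtr ?(eigenvalue_gram_ge0 eig_a) //.
by move: eig_a; rewrite trmxK.
Qed.

Lemma sigma_min_ge0 m n (M : 'M[R]_(m, n)) : 0 <= sigma_min M.
Proof.
have [M0|/set0P M_neq0] := eqVneq (singular_values M) set0.
  by rewrite /sigma_min M0 inf0.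
by apply: lb_le_inf M_neq0 _ => s [].
Qed.

(** An eigenvalue [a] of a positive semidefinite [K] is itself a singular value: it is nonnegative,
    and [a ^+ 2] is an eigenvalue of [K^T *m K]. Hence the infimum lies below every eigenvalue. *)
Lemma sigma_min_rayleigh n k (K : 'M[R]_n) (X : 'M[R]_(n, k)) : K^T = K ->
  (forall v : 'cV[R]_n, 0 <= mxdot v (K *m v)) ->
  sigma_min K * mxdot X X <= mxdot X (K *m X).
Proof.
move=> K_sym K_psd; apply: rayleigh_ge => // a eig_a.
apply: ge_inf; first by exists 0 => s [].
split; first have [v Kv v_gt0] := eigenvalue_rayleigh K_sym eig_a.
  by rewrite -(pmulr_lge0 a v_gt0) -Kv.
rewrite leqnn; have /eigenvalueP[v vK v_neq0] := eig_a.
apply/eigenvalueP; exists v => //.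
by rewrite K_sym mulmxA vK -scalemxAl vK scalerA.
Qed.

(** The least eigenvalue of [K^T *m K] is positive by injectivity, and its root bounds all singular
    values from below. The condition [0 < n] matters: for [n = 0] there are no singular values and
    the infimum is 0 by convention. *)
Lemma sigma_min_gt0 n (K : 'M[R]_n) : (0 < n)%N ->
  (forall v : 'cV[R]_n, K *m v = 0 -> v = 0) -> 0 < sigma_min K.
Proof.
move=> n_gt0 K_inj.
have [a eig_a a_min] := symmetric_eigenvalue_min n_gt0 (gram_sym K).
have a_gt0 : 0 < a.
  have [v Kv v_gt0] := eigenvalue_rayleigh (gram_sym K) eig_a.
  rewrite -(pmulr_lgt0 a v_gt0) -Kv mxdot_gram.
  rewrite exprn_gt0 // lt_def frob_ge0 andbT frob_eq0.
  apply: contraTneq v_gt0 => /K_inj ->.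
  by rewrite -(scale0r 0) mxdotZl mul0r ltxx.
apply: (@lt_le_trans _ _ (Num.sqrt a)); first by rewrite sqrtr_gt0.
apply: lb_le_inf => [|s [s_ge0]].
  exists (Num.sqrt a); split; first exact: sqrtr_ge0.
  by rewrite leqnn sqr_sqrtr // ltW.
rewrite leqnn => /a_min; rewrite -(ler_sqrt _ (sqr_ge0 s)) sqrtr_sqr.
by rewrite ger0_norm.
Qed.

(** * Sensitivity of constrained quadratic minimisers to the linear term *)

Lemma argmin_quadratic_monotone m n (K : 'M[R]_m) (S : set 'M[R]_(m, n))
    (g h X Y : 'M[R]_(m, n)) :
  K^T = K ->
  (forall U V (t : R), S U -> S V -> 0 <= t <= 1 -> S (U + t *: (V - U))) ->
  argmin S (fun U => \tr (U^T *m K *m U + 2 *: (g^T *m U))) X ->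
  argmin S (fun U => \tr (U^T *m K *m U + 2 *: (h^T *m U))) Y ->
  mxdot (X - Y) (K *m (X - Y)) <= mxdot (h - g) (X - Y).
Proof.
move=> K_sym S_cvx [SX X_min] [SY Y_min].
have costE (f U : 'M[R]_(m, n)) : \tr (U^T *m K *m U + 2 *: (f^T *m U)) =
    mxdot U (K *m U) + 2 * mxdot f U.
  by rewrite linearD linearZ /= -mulmxA.
(* [E] is made opaque so that the bilinear expansion below keeps the difference whole. *)
have [E EE] : exists E, X - Y = E by exists (X - Y).
rewrite EE; pose Q := mxdot E (K *m E); pose r := mxdot (h - g) E.
have sym (U V : 'M[R]_(m, n)) : mxdot U (K *m V) = mxdot V (K *m U).
  by rewrite mxdotC mxdot_mulmxl K_sym.
(* [X] is compared with [X - t *: E] and [Y] with [Y + t *: E]; adding the two inequalities and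
   dividing by [2 * t] gives the claim. *)
have step (t : R) : 0 < t <= 1 -> (1 - t) * Q <= r.
  move=> /andP[t_gt0 t_le1]; have t01 : 0 <= t <= 1 by rewrite ltW.
  have := X_min _ (S_cvx _ _ t SX SY t01).
  have := Y_min _ (S_cvx _ _ t SY SX t01).
  have -> : Y - X = (-1) *: E by rewrite -EE scaleN1r opprB.
  rewrite EE /r !costE.
  have -> : h - g = h + (-1) *: g by rewrite scaleN1r.
  rewrite !(mulmxDr, scalerA) -!scalemxAr.
  rewrite !(mxdotDl, mxdotDr, mxdotZl, mxdotZr).
  rewrite !(sym E X) !(sym E Y) -/Q.
  have QE : Q = mxdot X (K *m E) - mxdot Y (K *m E).
    by rewrite /Q -{1}EE mxdotDl -scaleN1r mxdotZl mulN1r.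
  move: (mxdot g E) (mxdot h E) => gE hE h1 h2.
  rewrite -(ler_pM2l t_gt0); nra.
have [Q_le0|Q_gt0] := leP Q 0.
  have := step 1; rewrite subrr mul0r ltr01 lexx => /(_ isT).
  exact: le_trans.
rewrite leNgt; apply/negP; rewrite -/Q -/r => r_lt_Q.
have r_ge0 : 0 <= r.
  by have := step 1; rewrite subrr mul0r ltr01 lexx => /(_ isT).
have Q2_gt0 : 0 < 2 * Q by rewrite mulr_gt0.
(* This [t] replaces the limit at 0: [step] gives [(Q + r) / 2 <= r], contradicting [r < Q]. It is
   at most 1 because [r] is nonnegative. *)
have := step ((Q - r) / (2 * Q)).
have -> : 0 < (Q - r) / (2 * Q) <= 1.
  by rewrite divr_gt0 ?subr_gt0 // ler_pdivrMr // mul1r; lra.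
move=> /(_ isT).
have -> : (1 - (Q - r) / (2 * Q)) * Q = (Q + r) / 2 by field; rewrite gt_eqF.
by move: r_lt_Q; clear; lra.
Qed.

(** * Convexity of the l1 ball and splitting of the inner product into blocks *)

Lemma l1norm_convex n (u v : 'cV[R]_n) t : 0 <= t <= 1 ->
  l1norm u <= 1 -> l1norm v <= 1 -> l1norm (u + t *: (v - u)) <= 1.
Proof.
move=> /andP[t_ge0 t_le1] u_le1 v_le1.
apply: (@le_trans _ _ ((1 - t) * l1norm u + t * l1norm v)); last by nra.
rewrite /l1norm !mulr_sumr -big_split ler_sum // => i _; rewrite !mxE.
have -> : u i 0 + t * (v i 0 - u i 0) = (1 - t) * u i 0 + t * v i 0 by ring.
rewrite (le_trans (ler_normD _ _)) // !normrM (ger0_norm t_ge0) ger0_norm //.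
by rewrite subr_ge0.
Qed.

Lemma mxdot_submxcol p (p_ : 'I_p -> nat) n (X Y : 'M[R]_(\sum_i p_ i, n)) :
  mxdot X Y = \sum_i mxdot (submxcol X i) (submxcol Y i).
Proof.
rewrite -{1}(submxcolK X) -{1}(submxcolK Y) /mxdot tr_mxcol mul_mxrow_mxcol.
exact: linear_sum.
Qed.

End InnerProduct.

(** * Best responses in the game *)

Section Game.
Variables (R : realType) (NP N Nx Nz : nat) (Nu : 'I_NP -> nat).
Variables (A : 'M[R]_Nx) (B : forall p : 'I_NP, 'M[R]_(Nx, Nu p)).
Variables (C : 'I_NP -> 'M[R]_(Nz, Nx)).
Variables (D : forall p q : 'I_NP, 'M[R]_(Nz, Nu q)).
Variables (Ng : 'I_NP -> nat) (G : forall p : 'I_NP, 'M[R]_(Ng p, Nu p)).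

Local Notation feasible p := (@feasible R NP N Nx Nu Ng G p).
Local Notation best_response p :=
  (@best_response R NP N Nx Nz Nu A B C D Ng G p).

Lemma feasible_convex p U V t : feasible p U -> feasible p V -> 0 <= t <= 1 ->
  feasible p (U + t *: (V - U)).
Proof.
move=> fU fV t01 j.
have -> : side_by_side (U + t *: (V - U)) =
    side_by_side U + t *: (side_by_side V - side_by_side U).
  by apply/matrixP => i k; rewrite !mxE.
rewrite mulmxDr -scalemxAr mulmxBr linearD linearZ /= linearB /=.
exact: l1norm_convex.
Qed.

Lemma Dop_tr_Cop p q : (D p q)^T *m C p = 0 -> (Dop N D p q)^T *m Cop N C p = 0.
Proof.
move=> DC; rewrite tr_mxblock mul_mxblock -[RHS]mxblock0.
apply: eq_mxblock => i j; apply: big1 => k _.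
by do 2![case: ifP => _]; rewrite ?trmx0 ?mul0mx ?mulmx0.
Qed.

Lemma Dop_inj p q k (v : 'M[R]_(\sum_(n < N.-1) Nu q, k)) :
  \rank (D p q) = Nu q -> Dop N D p q *m v = 0 -> v = 0.
Proof.
move=> D_rank; rewrite -{1}(submxcolK v) mul_mxblock_mxrow -mxcol0.
move=> /eq_mxcolP Dv; apply/mxcolP => m; rewrite submxcol0.
(* Block row [m] of the product, with [m] below [N.-1], is [D p q] times block [m] of [v]; full
   column rank then cancels [D p q]. *)
have := Dv (widen_ord (leq_pred N) m).
rewrite (bigD1 m) //= eqxx big1 => [|i /negPf i_m]; last first.
  by rewrite eq_sym val_eqE i_m mul0mx.
rewrite addr0 => /(congr1 trmx); rewrite trmx_mul trmx0 => /eqP.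
rewrite mulmx_free_eq0 ?trmx_eq0 => [/eqP//|].
by rewrite /row_free mxrank_tr D_rank.
Qed.

(** Since [H p p] is the Gram matrix of [M], its kernel is that of [M]. Multiplying [M *m v = 0] by
    the transpose of [Dop] removes the state term by orthogonality and leaves the Gram matrix of
    [Dop], which is injective by full column rank. *)
Lemma H_inj p k (v : 'M[R]_(\sum_(n < N.-1) Nu p, k)) :
  \rank (D p p) = Nu p -> (D p p)^T *m C p = 0 -> H N A B C D p p *m v = 0 ->
  v = 0.
Proof.
move=> D_rank DC Hv; set M := Cop N C p *m Fop N A B p + Dop N D p p.
have Mv : M *m v = 0.
  apply/eqP; rewrite -frob_eq0 -sqrf_eq0 -mxdot_gram /mxdot.
  by rewrite [_ *m v]Hv mulmx0 linear0.
have := congr1 (mulmx (Dop N D p p)^T) Mv.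
rewrite mulmx0 /M mulmxA mulmxDr mulmxA Dop_tr_Cop // mul0mx add0r => DDv.
apply: (Dop_inj D_rank); apply/eqP; rewrite -frob_eq0 -sqrf_eq0 -mxdot_gram.
by rewrite DDv /mxdot mulmx0 linear0.
Qed.

(** Leaving out player [p] drops one nonnegative term from the sum of squared block norms. *)
Lemma frob_others (Phi : 'M[R]_(\sum_p \sum_(n < N.-1) Nu p, Nx)) p :
  frob (others Phi p) <= frob Phi.
Proof.
rewrite -(@ler_pXn2r _ 2) ?nnegrE ?frob_ge0 // !frob_sqr !mxdot_submxcol.
rewrite [leRHS](bigD1_ord p) //=.
under eq_bigr do rewrite mxcolK.
by rewrite lerDr mxdot_ge0.
Qed.

Lemma othersB (Phi Psi : 'M[R]_(\sum_p \sum_(n < N.-1) Nu p, Nx)) p :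
  others (Phi - Psi) p = others Phi p - others Psi p.
Proof. by apply/matrixP => i j; rewrite !mxE. Qed.

Lemma best_response_lipschitz p Phi Psi X Y :
  \rank (D p p) = Nu p -> (D p p)^T *m C p = 0 ->
  best_response p Phi X ->
  best_response p Psi Y ->
  frob (X - Y) <= lip_player N A B C D p * frob (Phi - Psi).
Proof.
move=> D_rank DC X_br Y_br.
set K := H N A B C D p p.
have K_sym : K^T = K by exact: gram_sym.
have := argmin_quadratic_monotone K_sym (@feasible_convex p) X_br Y_br.
have -> : Hothers N A B C D p *m Psi + H0 N A B C D p -
    (Hothers N A B C D p *m Phi + H0 N A B C D p) =
    Hothers N A B C D p *m (Psi - Phi).
  by rewrite opprD addrACA subrr addr0 mulmxBr.
move=> monotone.
(* The case [X = Y] covers kernels without rows, where [sigma_min] is 0 and the quotient is 0 by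
   convention. Otherwise there is at least one row, so [sigma_min K] is positive and may be cleared
   from the denominator. *)
have [E0|E_neq0] := eqVneq (X - Y) 0.
  have /eqP -> : frob (X - Y) == 0 by rewrite frob_eq0 E0.
  rewrite mulr_ge0 ?frob_ge0 // divr_ge0 ?sigma_max_ge0 //.
  exact: sigma_min_ge0.
have E_gt0 : 0 < frob (X - Y) by rewrite lt_def frob_eq0 E_neq0 frob_ge0.
have size_gt0 : (0 < \sum_(n < N.-1) Nu p)%N by exact: matrix_neq0_rows E_neq0.
have s_gt0 : 0 < sigma_min K.
  by apply: sigma_min_gt0 size_gt0 _ => v; exact: H_inj.
rewrite /lip_player mulrAC ler_pdivlMr // -(ler_pM2r E_gt0) mulrC mulrA -expr2.
rewrite frob_sqr mulrC -mulrA; apply: le_trans (sigma_min_rayleigh _ K_sym _) _.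
  by move=> v; rewrite mxdot_gram sqr_ge0.
apply: le_trans monotone _; apply: le_trans (mxdot_le_frob _ _) _.
rewrite mulrA ler_wpM2r ?frob_ge0 // -(opprB Phi Psi) mulmxN frobN.
exact: frob_mulmx_le.
Qed.

End Game.

Theorem theorem4 (R : realType) (NP N Nx Nz : nat) (Nu : 'I_NP -> nat)
    (A : 'M[R]_Nx) (B : forall p : 'I_NP, 'M[R]_(Nx, Nu p))
    (C : 'I_NP -> 'M[R]_(Nz, Nx))
    (D : forall p q : 'I_NP, 'M[R]_(Nz, Nu q))
    (Ng : 'I_NP -> nat) (G : forall p : 'I_NP, 'M[R]_(Ng p, Nu p))
    (HN : (1 < N)%N)
    (Hstab : forall p, stabilisable A (B p))
    (Hdetect : forall p, detectable (C p) A)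
    (HDrank : forall p, \rank (D p p) = Nu p)
    (HDC : forall p q, (D p q)^T *m C p = 0)
    (HGrank : forall p, \rank (G p) = Ng p) :
  set_lipschitz
    (Num.sqrt (\sum_(p < NP) lip_player N A B C D p ^+ 2))
    (@joint_best_response R NP N Nx Nz Nu A B C D Ng G).
Proof.
move=> Phi Psi X Y X_br Y_br.
rewrite -(@ler_pXn2r _ 2) ?nnegrE ?mulr_ge0 ?frob_ge0 ?sqrtr_ge0 //.
(* Squared norms add over the players' blocks, so both sides become sums compared term by term, each
   player's bound being enlarged from the others' deviation to the whole of [Phi - Psi]. *)
rewrite frob_sqr mxdot_submxcol exprMn sqr_sqrtr; last first.
  by apply: sumr_ge0 => p _; exact: sqr_ge0.
rewrite mulr_suml ler_sum // => p _.
have L_ge0 : 0 <= lip_player N A B C D p.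
  by rewrite divr_ge0 ?sigma_max_ge0 ?sigma_min_ge0.
rewrite submxcolB -frob_sqr -exprMn.
rewrite ler_pXn2r ?nnegrE ?(mulr_ge0 L_ge0) ?frob_ge0 //.
apply: le_trans (best_response_lipschitz _ _ (X_br p) (Y_br p)) _ => //.
by rewrite -othersB ler_wpM2l ?frob_others.
Qed.
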